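(* The first-order theory $\mathscr{E}_d$ is consistent.
   Context: $\mathscr{E}_d$ is the following theory in two-sorted first-order logic with equality. Sorts: points (boldface variables $\mathbf{a},\mathbf{b},\dots$) and numbers (variables $x,y,\dots$). Language $L(d;=,+,\cdot,<,0,1)$: $d$ is a function symbol taking two points to a number, written $d(\mathbf{ab})$; $+,\cdot$ are binary function symbols on numbers, $<$ a binary predicate on numbers, $0,1$ number constants; $=$ is equality on either sort. $x\leqslant y$ abbreviates $x<y\vee x=y$. Axioms on numbers (real closed fields), RCF1-RCF17: the axioms of ordered fields, plus the schema RCF17: $[\forall x\forall y\ (\Phi(x)\wedge\Psi(y)\to x<y)]\to[\exists z\forall x\forall y\ (\Phi(x)\wedge\Psi(y)\to x\leqslant z\wedge z\leqslant y)]$ for all formulas $\Phi,\Psi$ of $L(=,+,\cdot,<,0,1)$ (other free variables allowed as parameters) with $x$ free in $\Phi$, $y$ free in $\Psi$, neither $y$ nor $z$ appearing in $\Phi$, neither $x$ nor $z$ appearing in $\Psi$. Geometric axioms (all free variables universally quantified): D1: $0\leqslant d(\mathbf{ab})$. D2: $d(\mathbf{ab})=0\leftrightarrow\mathbf{a}=\mathbf{b}$. D3: $d(\mathbf{ab})=d(\mathbf{ba})$. D4: $0\leqslant x\to\exists\mathbf{c}\,[d(\mathbf{ac})=d(\mathbf{ab})+d(\mathbf{bc})\wedge d(\mathbf{bc})=x]$. D5 (Similarity): $[d(\mathbf{ab})=d(\mathbf{ab'})+d(\mathbf{b'b})\wedge d(\mathbf{ac})=d(\mathbf{ac'})+d(\mathbf{c'c})\wedge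 d(\mathbf{ab'})\cdot d(\mathbf{ac})=d(\mathbf{ac'})\cdot d(\mathbf{ab})]\to d(\mathbf{ab'})\cdot d(\mathbf{bc})=d(\mathbf{b'c'})\cdot d(\mathbf{ab})$. D6: there exist points $\mathbf{p}_0,\mathbf{p}_1,\mathbf{p}_2$ with $d(\mathbf{p}_0\mathbf{p}_1)\ne0$ and $d(\mathbf{p}_0\mathbf{p}_1)=d(\mathbf{p}_0\mathbf{p}_2)=d(\mathbf{p}_1\mathbf{p}_2)$. D7: for all points $\mathbf{p}_0,\mathbf{p}_1,\mathbf{p}_2,\mathbf{p}_3$, if all six distances $d(\mathbf{p}_i\mathbf{p}_j)$, $0\le i<j\le3$, are equal, then $d(\mathbf{p}_0\mathbf{p}_1)=0$. *)

(* Defs.v *)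
From Stdlib Require Import List.
Import ListNotations.

(** * Two-sorted first-order logic over the language L(d; =, +, ., <, 0, 1) *)

(** Each sort has its own supply of variables, indexed by [nat]. *)
Inductive var : Type :=
| Pt (n : nat)
| Num (n : nat).

Lemma var_eq_dec (u v : var) : {u = v} + {u <> v}.
Proof. decide equality; decide equality. Defined.

Arguments var_eq_dec : simpl never.

(** Terms of sort number.  The language has no function symbol with values in
    points, so a term of sort point is a point variable and is represented by
    the index of that variable. *)
Inductive term : Type :=
| Var (x : nat)
| Dist (a b : nat)
| Zero
| One
| Add (s t : term)
| Mul (s t : term).

Inductive formula : Type :=
| EqPt (a b : nat)
| EqNum (s t : term)
| Lt (s t : term)
| Bot
| Imp (p q : formula)
| And (p q : formula)
| Or (p q : formula)
| All (v : var) (p : formula)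
| Ex (v : var) (p : formula).

Definition Neg (p : formula) : formula := Imp p Bot.
Definition Iff (p q : formula) : formula := And (Imp p q) (Imp q p).
Definition Le (s t : term) : formula := Or (Lt s t) (EqNum s t).

(** ** Occurrences of variables *)

Fixpoint term_vars (t : term) : list var :=
  match t with
  | Var x => [Num x]
  | Dist a b => [Pt a; Pt b]
  | Zero | One => []
  | Add s t | Mul s t => term_vars s ++ term_vars t
  end.

Fixpoint free_vars (p : formula) : list var :=
  match p with
  | EqPt a b => [Pt a; Pt b]
  | EqNum s t | Lt s t => term_vars s ++ term_vars t
  | Bot => []
  | Imp p q | And p q | Or p q => free_vars p ++ free_vars q
  | All v p | Ex v p => remove var_eq_dec v (free_vars p)
  end.

Definition free_in (v : var) (p : formula) : Prop := In v (free_vars p).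

(** [v] appears in [p]: free, bound, or only as the variable of a quantifier. *)
Fixpoint appears_in (v : var) (p : formula) : Prop :=
  match p with
  | EqPt a b => In v [Pt a; Pt b]
  | EqNum s t | Lt s t => In v (term_vars s ++ term_vars t)
  | Bot => False
  | Imp p q | And p q | Or p q => appears_in v p \/ appears_in v q
  | All u p | Ex u p => v = u \/ appears_in v p
  end.

Definition closure (p : formula) : formula := fold_right All p (nodup var_eq_dec (free_vars p)).

(** ** Substitution

    [subst_num x t] and [subst_pt a b] replace the free occurrences of [Num x]
    by [t], and of [Pt a] by [Pt b].  They do not rename bound variables:
    capture is excluded by [free_for] where they are used. *)

Fixpoint term_subst_num (x : nat) (t s : term) : term :=
  match s with
  | Var y => if PeanoNat.Nat.eq_dec x y then t else Var y
  | Dist a b => Dist a b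
  | Zero => Zero
  | One => One
  | Add s1 s2 => Add (term_subst_num x t s1) (term_subst_num x t s2)
  | Mul s1 s2 => Mul (term_subst_num x t s1) (term_subst_num x t s2)
  end.

Fixpoint subst_num (x : nat) (t : term) (p : formula) : formula :=
  match p with
  | EqPt a b => EqPt a b
  | EqNum s1 s2 => EqNum (term_subst_num x t s1) (term_subst_num x t s2)
  | Lt s1 s2 => Lt (term_subst_num x t s1) (term_subst_num x t s2)
  | Bot => Bot
  | Imp p q => Imp (subst_num x t p) (subst_num x t q)
  | And p q => And (subst_num x t p) (subst_num x t q)
  | Or p q => Or (subst_num x t p) (subst_num x t q)
  | All v p => All v (if var_eq_dec (Num x) v then p else subst_num x t p)
  | Ex v p => Ex v (if var_eq_dec (Num x) v then p else subst_num x t p)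
  end.

Definition rename (a b c : nat) : nat :=
  if PeanoNat.Nat.eq_dec a c then b else c.

Fixpoint term_subst_pt (a b : nat) (s : term) : term :=
  match s with
  | Var y => Var y
  | Dist c1 c2 => Dist (rename a b c1) (rename a b c2)
  | Zero => Zero
  | One => One
  | Add s1 s2 => Add (term_subst_pt a b s1) (term_subst_pt a b s2)
  | Mul s1 s2 => Mul (term_subst_pt a b s1) (term_subst_pt a b s2)
  end.

Fixpoint subst_pt (a b : nat) (p : formula) : formula :=
  match p with
  | EqPt c1 c2 => EqPt (rename a b c1) (rename a b c2)
  | EqNum s1 s2 => EqNum (term_subst_pt a b s1) (term_subst_pt a b s2)
  | Lt s1 s2 => Lt (term_subst_pt a b s1) (term_subst_pt a b s2)
  | Bot => Bot
  | Imp p q => Imp (subst_pt a b p) (subst_pt a b q)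
  | And p q => And (subst_pt a b p) (subst_pt a b q)
  | Or p q => Or (subst_pt a b p) (subst_pt a b q)
  | All v p => All v (if var_eq_dec (Pt a) v then p else subst_pt a b p)
  | Ex v p => Ex v (if var_eq_dec (Pt a) v then p else subst_pt a b p)
  end.

(** No free occurrence of [v] in [p] lies in the scope of a quantifier binding
    a variable of [ws]; [ws] is the list of variables of the term put for [v]. *)
Fixpoint free_for (v : var) (ws : list var) (p : formula) : Prop :=
  match p with
  | EqPt _ _ | EqNum _ _ | Lt _ _ | Bot => True
  | Imp p q | And p q | Or p q => free_for v ws p /\ free_for v ws q
  | All u q | Ex u q =>
      ~ free_in v p \/ (~ In u ws /\ free_for v ws q)
  end.

(** ** Classical natural deduction with equality *)

Definition not_free_in_all (v : var) (G : list formula) : Prop :=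
  forall p, In p G -> ~ free_in v p.

Inductive entails : list formula -> formula -> Prop :=
| E_hyp G p : In p G -> entails G p
| E_weak G G' p : incl G G' -> entails G p -> entails G' p
| E_raa G p : entails (Neg p :: G) Bot -> entails G p
| E_imp_i G p q : entails (p :: G) q -> entails G (Imp p q)
| E_imp_e G p q : entails G (Imp p q) -> entails G p -> entails G q
| E_and_i G p q : entails G p -> entails G q -> entails G (And p q)
| E_and_e1 G p q : entails G (And p q) -> entails G p
| E_and_e2 G p q : entails G (And p q) -> entails G q
| E_or_i1 G p q : entails G p -> entails G (Or p q)
| E_or_i2 G p q : entails G q -> entails G (Or p q)
| E_or_e G p q r :
    entails G (Or p q) -> entails (p :: G) r -> entails (q :: G) r ->
    entails G r
| E_all_i G v p :
    not_free_in_all v G -> entails G p -> entails G (All v p)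
| E_all_num_e G x p t :
    free_for (Num x) (term_vars t) p ->
    entails G (All (Num x) p) -> entails G (subst_num x t p)
| E_all_pt_e G a p b :
    free_for (Pt a) [Pt b] p ->
    entails G (All (Pt a) p) -> entails G (subst_pt a b p)
| E_ex_num_i G x p t :
    free_for (Num x) (term_vars t) p ->
    entails G (subst_num x t p) -> entails G (Ex (Num x) p)
| E_ex_pt_i G a p b :
    free_for (Pt a) [Pt b] p ->
    entails G (subst_pt a b p) -> entails G (Ex (Pt a) p)
| E_ex_e G v p q :
    not_free_in_all v G -> ~ free_in v q ->
    entails G (Ex v p) -> entails (p :: G) q -> entails G q
| E_eq_num_refl G t : entails G (EqNum t t)
| E_eq_num_subst G x s t p :
    free_for (Num x) (term_vars s) p -> free_for (Num x) (term_vars t) p ->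
    entails G (EqNum s t) -> entails G (subst_num x s p) ->
    entails G (subst_num x t p)
| E_eq_pt_refl G a : entails G (EqPt a a)
| E_eq_pt_subst G c a b p :
    free_for (Pt c) [Pt a] p -> free_for (Pt c) [Pt b] p ->
    entails G (EqPt a b) -> entails G (subst_pt c a p) ->
    entails G (subst_pt c b p).

Definition provable (T : formula -> Prop) (p : formula) : Prop :=
  exists G : list formula, (forall q, In q G -> T q) /\ entails G p.

Definition consistent (T : formula -> Prop) : Prop := ~ provable T Bot.

(** * The axioms *)

Declare Scope fol_scope.
Delimit Scope fol_scope with fol.
Notation "0" := Zero : fol_scope.
Notation "1" := One : fol_scope.
Infix "+" := Add : fol_scope.
Infix "*" := Mul : fol_scope.
Infix "==" := EqNum (at level 70, no associativity) : fol_scope.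
Infix "=p=" := EqPt (at level 70, no associativity) : fol_scope.
Infix "<" := Lt : fol_scope.
Infix "<=" := Le : fol_scope.
Notation "~ p" := (Neg p) : fol_scope.
Infix "/\" := And : fol_scope.
Infix "\/" := Or : fol_scope.
Infix "==>" := Imp (at level 90, right associativity) : fol_scope.
Infix "<==>" := Iff (at level 95, no associativity) : fol_scope.

Section Theory.

Local Open Scope fol_scope.

Let x := Var 0.
Let y := Var 1.
Let z := Var 2.

Definition ordered_field_axioms : list formula :=
  [ x + (y + z) == (x + y) + z;
    x + y == y + x;
    x + 0 == x;
    Ex (Num 1) (x + y == 0);
    x * (y * z) == (x * y) * z;
    x * y == y * x;
    x * 1 == x;
    ~ (x == 0) ==> Ex (Num 1) (x * y == 1);
    x * (y + z) == x * y + x * z;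
    ~ (0 == 1);
    ~ (x < x);
    x < y /\ y < z ==> x < z;
    x < y \/ x == y \/ y < x;
    x < y ==> x + z < y + z;
    0 < x /\ 0 < y ==> 0 < x * y ].

(** Membership in the one-sorted language L(=, +, ., <, 0, 1). *)
Fixpoint number_term (t : term) : Prop :=
  match t with
  | Dist _ _ => False
  | Var _ | Zero | One => True
  | Add s t | Mul s t => number_term s /\ number_term t
  end.

Definition number_var (v : var) : Prop :=
  match v with Num _ => True | Pt _ => False end.

Fixpoint number_formula (p : formula) : Prop :=
  match p with
  | EqPt _ _ => False
  | EqNum s t | Lt s t => number_term s /\ number_term t
  | Bot => True
  | Imp p q | And p q | Or p q => number_formula p /\ number_formula q
  | All v p | Ex v p => number_var v /\ number_formula p
  end.

(** The schema of continuity; here the indices [i], [j], [k] stand for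
    the variables called x, y, z.  The side conditions force them to be
    pairwise distinct. *)
Inductive continuity_axiom : formula -> Prop :=
| Continuity (i j k : nat) (Phi Psi : formula) :
    number_formula Phi -> number_formula Psi ->
    free_in (Num i) Phi -> free_in (Num j) Psi ->
    ~ appears_in (Num j) Phi -> ~ appears_in (Num k) Phi ->
    ~ appears_in (Num i) Psi -> ~ appears_in (Num k) Psi ->
    continuity_axiom
      (All (Num i) (All (Num j) (Phi /\ Psi ==> Var i < Var j)) ==>
       Ex (Num k) (All (Num i) (All (Num j)
         (Phi /\ Psi ==> Var i <= Var k /\ Var k <= Var j)))).

Let a := 0%nat.
Let b := 1%nat.
Let c := 2%nat.
Let b' := 3%nat.
Let c' := 4%nat.

Let p0 := 0%nat.
Let p1 := 1%nat.
Let p2 := 2%nat.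
Let p3 := 3%nat.

Definition D1 : formula := 0 <= Dist a b.

Definition D2 : formula := Dist a b == 0 <==> a =p= b.

Definition D3 : formula := Dist a b == Dist b a.

Definition D4 : formula :=
  0 <= x ==>
  Ex (Pt c) (Dist a c == Dist a b + Dist b c /\ Dist b c == x).

(** Similarity. *)
Definition D5 : formula :=
  Dist a b == Dist a b' + Dist b' b /\
  Dist a c == Dist a c' + Dist c' c /\
  Dist a b' * Dist a c == Dist a c' * Dist a b ==>
  Dist a b' * Dist b c == Dist b' c' * Dist a b.

(** There is a nondegenerate equilateral triangle. *)
Definition D6 : formula :=
  Ex (Pt p0) (Ex (Pt p1) (Ex (Pt p2)
    (~ (Dist p0 p1 == 0) /\
     Dist p0 p1 == Dist p0 p2 /\ Dist p0 p2 == Dist p1 p2))).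

(** There is no nondegenerate regular tetrahedron. *)
Definition D7 : formula :=
  Dist p0 p1 == Dist p0 p2 /\ Dist p0 p2 == Dist p0 p3 /\
  Dist p0 p3 == Dist p1 p2 /\ Dist p1 p2 == Dist p1 p3 /\
  Dist p1 p3 == Dist p2 p3 ==>
  Dist p0 p1 == 0.

Definition geometric_axioms : list formula := [D1; D2; D3; D4; D5; D6; D7].

End Theory.

(** The theory consists of the universal closures of the axioms. *)
Definition E_d (s : formula) : Prop :=
  exists p : formula,
    (In p ordered_field_axioms \/ continuity_axiom p \/
     In p geometric_axioms) /\
    s = closure p.

(* Main.v *)
From Stdlib Require Import Reals Lra Psatz List Classical Eqdep_dec.
Require Import Defs.
Import ListNotations.

(** The theory is true in the Euclidean plane over the real numbers, and the
    deduction system is sound for truth in two-sorted structures.  The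
    continuity schema holds for arbitrary sets of reals by the least upper
    bound property.  Equality in the triangle inequality makes vectors
    proportional, which gives D5; D7 is the vanishing of the Gram determinant
    of three vectors of the plane. *)

(** * Soundness *)

Record structure : Type := {
  point : Type;
  number : Type;
  dist : point -> point -> number;
  zero : number;
  one : number;
  add : number -> number -> number;
  mul : number -> number -> number;
  less : number -> number -> Prop
}.

Definition value (M : structure) (v : var) : Type :=
  match v with Pt _ => point M | Num _ => number M end.

Definition env (M : structure) : Type := forall v : var, value M v.

(** The type of a value depends on the sort of its variable, so one function serves both sorts and
    the new value is transported along the equality of the two variables. *)
Definition upd {M : structure} (rho : env M) (v : var) (a : value M v) : env M :=
  fun u => match var_eq_dec v u with
           | left e => eq_rect v (value M) a u e
           | right _ => rho u
           end.

Lemma upd_same (M : structure) (rho : env M) v a : upd rho v a v = a.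
Proof.
  unfold upd; destruct (var_eq_dec v v) as [e | ne]; [| now destruct ne].
  (* The transport runs along some proof of [v = v]; as equality of variables is decidable, that
     proof is [eq_refl]. *)
  now rewrite (UIP_dec var_eq_dec e eq_refl).
Qed.

Lemma upd_other (M : structure) (rho : env M) v a u :
  v <> u -> upd rho v a u = rho u.
Proof. intros ne; unfold upd; now destruct (var_eq_dec v u). Qed.

Fixpoint eval {M : structure} (rho : env M) (t : term) : number M :=
  match t with
  | Var x => rho (Num x)
  | Dist a b => dist M (rho (Pt a)) (rho (Pt b))
  | Zero => zero M
  | One => one M
  | Add s t => add M (eval rho s) (eval rho t)
  | Mul s t => mul M (eval rho s) (eval rho t)
  end.

Fixpoint sat {M : structure} (rho : env M) (p : formula) : Prop :=
  match p with
  | EqPt a b => rho (Pt a) = rho (Pt b)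
  | EqNum s t => eval rho s = eval rho t
  | Lt s t => less M (eval rho s) (eval rho t)
  | Bot => False
  | Imp p q => sat rho p -> sat rho q
  | And p q => sat rho p /\ sat rho q
  | Or p q => sat rho p \/ sat rho q
  | All v p => forall a, sat (upd rho v a) p
  | Ex v p => exists a, sat (upd rho v a) p
  end.

(** * Truth depends only on the free variables *)

Lemma eval_ext (M : structure) (rho rho' : env M) t :
  (forall v, In v (term_vars t) -> rho v = rho' v) -> eval rho t = eval rho' t.
Proof.
  induction t as [x | a b | | | s IHs t IHt | s IHs t IHt]; simpl; intros H; auto.
  - now rewrite (H (Num x)) by auto.
  - now rewrite (H (Pt a)), (H (Pt b)) by auto.
  - rewrite IHs, IHt; auto; intros; apply H, in_or_app; auto.
  - rewrite IHs, IHt; auto; intros; apply H, in_or_app; auto.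
Qed.

Lemma upd_ext (M : structure) (rho rho' : env M) v a p :
  (forall u, In u (remove var_eq_dec v (free_vars p)) -> rho u = rho' u) ->
  forall u, free_in u p -> upd rho v a u = upd rho' v a u.
Proof.
  intros H u Hu; destruct (var_eq_dec v u) as [<- | ne].
  - now rewrite !upd_same.
  - rewrite !upd_other by assumption; apply H, in_in_remove; auto.
Qed.

Lemma sat_ext (M : structure) p : forall rho rho' : env M,
  (forall v, free_in v p -> rho v = rho' v) -> (sat rho p <-> sat rho' p).
Proof.
  unfold free_in.
  induction p as [a b | s t | s t | | p IHp q IHq | p IHp q IHq | p IHp q IHq
                 | v p IHp | v p IHp]; simpl; intros rho rho' H;
    try (rewrite (IHp rho rho'), (IHq rho rho');
         [reflexivity | intros; apply H, in_or_app; auto ..]).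
  - now rewrite (H (Pt a)), (H (Pt b)) by auto.
  - rewrite (eval_ext M rho rho' s), (eval_ext M rho rho' t);
      [reflexivity | intros; apply H, in_or_app; auto ..].
  - rewrite (eval_ext M rho rho' s), (eval_ext M rho rho' t);
      [reflexivity | intros; apply H, in_or_app; auto ..].
  - reflexivity.
  - split; intros Hp a; apply (IHp _ _ (upd_ext M rho rho' v a p H)), Hp.
  - split; intros [a Hp]; exists a; apply (IHp _ _ (upd_ext M rho rho' v a p H)), Hp.
Qed.

Lemma sat_upd_not_free (M : structure) (rho : env M) v a p :
  ~ free_in v p -> (sat (upd rho v a) p <-> sat rho p).
Proof.
  intros Hv; apply sat_ext; intros u Hu; apply upd_other; congruence.
Qed.

Lemma sat_upd_upd (M : structure) (rho : env M) v a b p :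
  sat (upd (upd rho v a) v b) p <-> sat (upd rho v b) p.
Proof.
  apply sat_ext; intros u _; destruct (var_eq_dec v u) as [<- | ne].
  - now rewrite !upd_same.
  - now rewrite !upd_other.
Qed.

(** This is the quantifier step of the substitution lemmas. There [a] and [a'] are the values of the
    substituted term before and after [u] is bound; they may differ only when [v] is not free in
    [p], and then the value at [v] is irrelevant. *)
Lemma sat_upd_comm (M : structure) (rho : env M) u v a a' b p :
  v <> u -> ~ free_in v p \/ a' = a ->
  (sat (upd (upd rho u b) v a') p <-> sat (upd (upd rho v a) u b) p).
Proof.
  intros ne H; apply sat_ext; intros w Hw.
  destruct (var_eq_dec u w) as [<- | nu].
  - rewrite upd_other by auto; now rewrite !upd_same.
  - rewrite (upd_other M _ u) by auto.
    destruct (var_eq_dec v w) as [<- | nv].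
    + rewrite !upd_same; destruct H; tauto.
    + now rewrite !upd_other.
Qed.

(** * Substitution in a formula as an update of the environment *)

Lemma not_free_free_for v ws p : ~ free_in v p -> free_for v ws p.
Proof.
  unfold free_in; induction p; simpl; rewrite ?in_app_iff; tauto.
Qed.

(** Passes from a quantified formula to its body: the first conjunct feeds the induction hypothesis,
    the second is the absence of capture in the form that [sat_upd_comm] can use. As [v] differs
    from the bound variable, not being free in the quantified formula means not being free in the
    body. *)
Lemma free_for_scope v ws u p :
  v <> u ->
  ~ In v (remove var_eq_dec u (free_vars p)) \/ (~ In u ws /\ free_for v ws p) ->
  free_for v ws p /\ (~ free_in v p \/ ~ In u ws).
Proof.
  intros ne [H | [Hu Hp]]; [| auto].
  assert (~ free_in v p) by (intros Hv; apply H, in_in_remove; auto).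
  split; [now apply not_free_free_for | auto].
Qed.

Lemma eval_upd_not_in (M : structure) (rho : env M) u b t :
  ~ In u (term_vars t) -> eval (upd rho u b) t = eval rho t.
Proof. intros Hu; apply eval_ext; intros v Hv; apply upd_other; congruence. Qed.

Lemma eval_subst_num (M : structure) (rho : env M) x t s :
  eval rho (term_subst_num x t s) = eval (upd rho (Num x) (eval rho t)) s.
Proof.
  induction s as [y | a b | | | s1 IH1 s2 IH2 | s1 IH1 s2 IH2]; simpl; try congruence.
  - destruct (PeanoNat.Nat.eq_dec x y) as [<- | ne].
    + now rewrite upd_same.
    + rewrite upd_other by congruence; reflexivity.
  - now rewrite !upd_other by discriminate.
Qed.

Lemma sat_subst_num (M : structure) x t p : forall rho : env M,
  free_for (Num x) (term_vars t) p ->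
  (sat rho (subst_num x t p) <-> sat (upd rho (Num x) (eval rho t)) p).
Proof.
  induction p as [a b | s1 s2 | s1 s2 | | p IHp q IHq | p IHp q IHq | p IHp q IHq
                 | u p IHp | u p IHp]; intros rho;
    try (simpl; intros [Hp Hq]; rewrite IHp, IHq by assumption; reflexivity).
  - intros _; simpl; now rewrite !upd_other by discriminate.
  - intros _; simpl; now rewrite !eval_subst_num.
  - intros _; simpl; now rewrite !eval_subst_num.
  - reflexivity.
  (* If the quantifier binds the substituted variable itself, the substitution stops there and the
     quantifier overwrites the update. *)
  - cbn -[upd]; intros Hf; destruct (var_eq_dec (Num x) u) as [<- | ne].
    + split; intros H b; specialize (H b); rewrite sat_upd_upd in *; exact H.
    + destruct (free_for_scope _ _ _ _ ne Hf) as [Hp Hu].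
      assert (E : forall b, sat (upd rho u b) (subst_num x t p) <->
                  sat (upd (upd rho (Num x) (eval rho t)) u b) p).
      { intros b; rewrite IHp by assumption; apply sat_upd_comm; auto.
        destruct Hu as [Hu | Hu]; auto; right; now apply eval_upd_not_in. }
      split; intros H b; apply E, H.
  - cbn -[upd]; intros Hf; destruct (var_eq_dec (Num x) u) as [<- | ne].
    + split; intros [b H]; exists b; rewrite sat_upd_upd in *; exact H.
    + destruct (free_for_scope _ _ _ _ ne Hf) as [Hp Hu].
      assert (E : forall b, sat (upd rho u b) (subst_num x t p) <->
                  sat (upd (upd rho (Num x) (eval rho t)) u b) p).
      { intros b; rewrite IHp by assumption; apply sat_upd_comm; auto.
        destruct Hu as [Hu | Hu]; auto; right; now apply eval_upd_not_in. }
      split; intros [b H]; exists b; apply E, H.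
Qed.

Lemma env_rename (M : structure) (rho : env M) a b c :
  rho (Pt (rename a b c)) = upd rho (Pt a) (rho (Pt b)) (Pt c).
Proof.
  unfold rename; destruct (PeanoNat.Nat.eq_dec a c) as [<- | ne].
  - now rewrite upd_same.
  - rewrite upd_other by congruence; reflexivity.
Qed.

Lemma eval_subst_pt (M : structure) (rho : env M) a b s :
  eval rho (term_subst_pt a b s) = eval (upd rho (Pt a) (rho (Pt b))) s.
Proof.
  induction s as [y | c d | | | s1 IH1 s2 IH2 | s1 IH1 s2 IH2]; simpl; try congruence.
  - now rewrite upd_other by discriminate.
  - now rewrite <- !env_rename.
Qed.

Lemma sat_subst_pt (M : structure) a b p : forall rho : env M,
  free_for (Pt a) [Pt b] p ->
  (sat rho (subst_pt a b p) <-> sat (upd rho (Pt a) (rho (Pt b))) p).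
Proof.
  induction p as [c d | s1 s2 | s1 s2 | | p IHp q IHq | p IHp q IHq | p IHp q IHq
                 | u p IHp | u p IHp]; intros rho;
    try (simpl; intros [Hp Hq]; rewrite IHp, IHq by assumption; reflexivity).
  - intros _; simpl; now rewrite <- !env_rename.
  - intros _; simpl; now rewrite !eval_subst_pt.
  - intros _; simpl; now rewrite !eval_subst_pt.
  - reflexivity.
  - cbn -[upd In]; intros Hf; destruct (var_eq_dec (Pt a) u) as [<- | ne].
    + split; intros H c; specialize (H c); rewrite sat_upd_upd in *; exact H.
    + destruct (free_for_scope _ _ _ _ ne Hf) as [Hp Hu].
      assert (E : forall c, sat (upd rho u c) (subst_pt a b p) <->
                  sat (upd (upd rho (Pt a) (rho (Pt b))) u c) p).
      { intros c; rewrite IHp by assumption; apply sat_upd_comm; auto.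
        destruct Hu as [Hu | Hu]; auto; right; apply (upd_other M rho u c (Pt b)).
        intros ->; apply Hu; left; reflexivity. }
      split; intros H c; apply E, H.
  - cbn -[upd In]; intros Hf; destruct (var_eq_dec (Pt a) u) as [<- | ne].
    + split; intros [c H]; exists c; rewrite sat_upd_upd in *; exact H.
    + destruct (free_for_scope _ _ _ _ ne Hf) as [Hp Hu].
      assert (E : forall c, sat (upd rho u c) (subst_pt a b p) <->
                  sat (upd (upd rho (Pt a) (rho (Pt b))) u c) p).
      { intros c; rewrite IHp by assumption; apply sat_upd_comm; auto.
        destruct Hu as [Hu | Hu]; auto; right; apply (upd_other M rho u c (Pt b)).
        intros ->; apply Hu; left; reflexivity. }
      split; intros [c H]; exists c; apply E, H.
Qed.

(** * Soundness of the deduction rules *)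

Definition models {M : structure} (rho : env M) (G : list formula) : Prop :=
  forall q, In q G -> sat rho q.

Lemma models_cons (M : structure) (rho : env M) p G :
  sat rho p -> models rho G -> models rho (p :: G).
Proof. intros Hp HG q [<- | Hq]; auto. Qed.

Lemma models_upd (M : structure) (rho : env M) v a G :
  not_free_in_all v G -> models rho G -> models (upd rho v a) G.
Proof. intros Hv HG q Hq; apply sat_upd_not_free; auto. Qed.

Lemma soundness (M : structure) G p :
  entails G p -> forall rho : env M, models rho G -> sat rho p.
Proof.
  induction 1 as
    [ G p Hp | G G' p Hi _ IH | G p _ IH | G p q _ IH | G p q _ IH1 _ IH2
    | G p q _ IH1 _ IH2 | G p q _ IH | G p q _ IH | G p q _ IH | G p q _ IH
    | G p q r _ IH1 _ IH2 _ IH3 | G v p Hv _ IH | G x p t Hf _ IH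
    | G a p b Hf _ IH | G x p t Hf _ IH | G a p b Hf _ IH
    | G v p q Hv Hq _ IH1 _ IH2 | G t | G x s t p Hs Ht _ IH1 _ IH2 | G a
    | G c a b p Ha Hb _ IH1 _ IH2 ]; intros rho HG; simpl.
  - now apply HG.
  - apply IH; intros q Hq; apply HG, Hi, Hq.
  (* Proof by contradiction is the one rule that calls for classical logic in the metatheory. *)
  - apply NNPP; intros Hn; apply (IH rho), models_cons; assumption.
  - intros Hp; apply IH, models_cons; assumption.
  - apply (IH1 rho HG), IH2, HG.
  - split; auto.
  - apply (IH rho HG).
  - apply (IH rho HG).
  - left; auto.
  - right; auto.
  - destruct (IH1 rho HG); [apply IH2 | apply IH3]; now apply models_cons.
  - intros a; apply IH; now apply models_upd.
  - apply sat_subst_num; [assumption | apply (IH rho HG)].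
  - apply sat_subst_pt; [assumption | apply (IH rho HG)].
  - exists (eval rho t); apply sat_subst_num; auto.
  - exists (rho (Pt b)); apply sat_subst_pt; auto.
  - destruct (IH1 rho HG) as [a Hp].
    apply (sat_upd_not_free M rho v a); [assumption |].
    apply IH2, models_cons; [assumption | now apply models_upd].
  - reflexivity.
  (* Both instances of [p] become the truth of [p] under an update of [x], and the two updates carry
     the same value. *)
  - apply sat_subst_num; [assumption |].
    rewrite <- (IH1 rho HG : eval rho s = eval rho t).
    apply sat_subst_num; auto.
  - reflexivity.
  - apply sat_subst_pt; [assumption |].
    rewrite <- (IH1 rho HG : rho (Pt a) = rho (Pt b)).
    apply sat_subst_pt; auto.
Qed.

Lemma sat_closure (M : structure) p :
  (forall rho : env M, sat rho p) -> forall rho : env M, sat rho (closure p).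
Proof.
  intros Hp; unfold closure; induction (nodup var_eq_dec (free_vars p)); simpl; auto.
Qed.

(** A derivation of [Bot] would make [Bot] true under some environment. One must exist, since
    otherwise truth under every environment would be vacuous. *)
Lemma model_consistent (M : structure) (T : formula -> Prop) :
  inhabited (env M) -> (forall p, T p -> forall rho : env M, sat rho p) -> consistent T.
Proof.
  intros [rho] HT [G [HG H]]; apply (soundness M G Bot H rho).
  intros q Hq; apply HT, HG, Hq.
Qed.

Lemma free_in_appears v p : free_in v p -> appears_in v p.
Proof.
  unfold free_in; induction p; simpl; rewrite ?in_app_iff; try tauto;
    intros Hv; apply in_remove in Hv; tauto.
Qed.

(** * The Euclidean plane *)

Local Open Scope R_scope.

Definition edist (p q : R * R) : R := dist_euc (fst p) (snd p) (fst q) (snd q).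

Definition plane : structure :=
  {| point := R * R; number := R; dist := edist; zero := 0; one := 1;
     add := Rplus; mul := Rmult; less := Rlt |}.

Lemma edist_nonneg p q : 0 <= edist p q.
Proof. apply sqrt_pos. Qed.

(** Together with [edist_unique] and nonnegativity, this replaces square roots by polynomial
    identities. *)
Lemma edist_sqr p q :
  edist p q * edist p q = (fst p - fst q) * (fst p - fst q) + (snd p - snd q) * (snd p - snd q).
Proof.
  unfold edist, dist_euc; apply sqrt_sqrt, Rplus_le_le_0_compat; apply Rle_0_sqr.
Qed.

Lemma edist_unique p q r :
  0 <= r ->
  r * r = (fst p - fst q) * (fst p - fst q) + (snd p - snd q) * (snd p - snd q) ->
  edist p q = r.
Proof.
  intros Hr H; apply Rsqr_inj; [apply edist_nonneg | assumption |].
  unfold Rsqr; now rewrite edist_sqr.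
Qed.

Lemma edist_sym p q : edist p q = edist q p.
Proof. apply distance_symm. Qed.

Lemma edist_refl p : edist p p = 0.
Proof. apply distance_refl. Qed.

Lemma edist_eq_0 p q : edist p q = 0 <-> p = q.
Proof.
  split; [| intros <-; apply edist_refl].
  intros H; pose proof (edist_sqr p q) as E; rewrite H in E.
  destruct p as [p1 p2], q as [q1 q2]; simpl in E.
  destruct (Rplus_sqr_eq_0 (p1 - q1) (p2 - q2)); [unfold Rsqr; lra |].
  f_equal; lra.
Qed.

(* For u = b' - a and v = b - b', equality in the triangle inequality gives
   u . v = |u| |v|, hence | |v| u - |u| v |^2 = 0. *)
Lemma edist_between a b b' :
  edist a b = edist a b' + edist b' b ->
  edist a b * (fst b' - fst a) = edist a b' * (fst b - fst a) /\
  edist a b * (snd b' - snd a) = edist a b' * (snd b - snd a).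
Proof.
  intros H.
  pose proof (edist_sqr a b) as E; pose proof (edist_sqr a b') as E1;
    pose proof (edist_sqr b' b) as E2.
  rewrite H in *; clear H.
  set (U := edist a b') in *; set (V := edist b' b) in *; clearbody U V.
  destruct a as [a1 a2], b as [b1 b2], b' as [c1 c2]; simpl in *.
  set (u1 := c1 - a1); set (u2 := c2 - a2); set (v1 := b1 - c1); set (v2 := b2 - c2).
  replace (b1 - a1) with (u1 + v1) by (unfold u1, v1; ring).
  replace (b2 - a2) with (u2 + v2) by (unfold u2, v2; ring).
  assert (HU : U * U = u1 * u1 + u2 * u2) by (rewrite E1; unfold u1, u2; ring).
  assert (HV : V * V = v1 * v1 + v2 * v2) by (rewrite E2; unfold v1, v2; ring).
  (* Expanding the square of [U + V], the length of u + v, leaves the inner product as the cross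
     term. *)
  assert (HUV : U * V = u1 * v1 + u2 * v2).
  { assert ((U + V) * (U + V) = (u1 + v1) * (u1 + v1) + (u2 + v2) * (u2 + v2))
      by (rewrite E; unfold u1, u2, v1, v2; ring).
    nra. }
  assert (Z : (V * u1 - U * v1) * (V * u1 - U * v1)
            + (V * u2 - U * v2) * (V * u2 - U * v2) = 0).
  { transitivity ((V * V) * (u1 * u1 + u2 * u2) + (U * U) * (v1 * v1 + v2 * v2)
                  - 2 * (U * V) * (u1 * v1 + u2 * v2)); [ring |].
    rewrite <- HU, <- HV, <- HUV; ring. }
  (* Both coordinates of V u - U v vanish; adding U u to each side of V u = U v gives (U + V) u = U
     (u + v). *)
  destruct (Rplus_sqr_eq_0 _ _ Z).
  split; lra.
Qed.

Lemma edist_scale p q p' q' r s :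
  0 <= r -> 0 <= s ->
  r * (fst p - fst q) = s * (fst p' - fst q') ->
  r * (snd p - snd q) = s * (snd p' - snd q') ->
  r * edist p q = s * edist p' q'.
Proof.
  intros Hr Hs H1 H2.
  pose proof (edist_nonneg p q); pose proof (edist_nonneg p' q').
  apply Rsqr_inj; [now apply Rmult_le_pos .. |].
  unfold Rsqr.
  transitivity ((r * r) * (edist p q * edist p q)); [ring |].
  transitivity ((s * s) * (edist p' q' * edist p' q')); [| ring].
  rewrite !edist_sqr.
  transitivity ((r * (fst p - fst q)) * (r * (fst p - fst q))
              + (r * (snd p - snd q)) * (r * (snd p - snd q))); [ring |].
  rewrite H1, H2; ring.
Qed.

Lemma edist_extend a b x :
  0 <= x -> exists c, edist a c = edist a b + edist b c /\ edist b c = x.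
Proof.
  intros Hx.
  (* A unit vector pointing from [a] to [b]. If the points coincide, every direction will do and (1,
     0) is taken. *)
  assert (D : exists e1 e2 : R, e1 * e1 + e2 * e2 = 1 /\
    fst b - fst a = edist a b * e1 /\ snd b - snd a = edist a b * e2).
  { pose proof (edist_sqr a b) as E.
    destruct (Req_dec (edist a b) 0) as [Z | N].
    - exists 1, 0; rewrite Z; apply edist_eq_0 in Z; subst b; lra.
    - exists ((fst b - fst a) / edist a b), ((snd b - snd a) / edist a b).
      repeat split; try (field; assumption).
      transitivity (((fst a - fst b) * (fst a - fst b) + (snd a - snd b) * (snd a - snd b))
                    / (edist a b * edist a b)); [field; assumption |].
      rewrite <- E; field; assumption. }
  destruct D as [e1 [e2 [He [H1 H2]]]].
  exists (fst b + x * e1, snd b + x * e2).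
  assert (Hb : edist b (fst b + x * e1, snd b + x * e2) = x).
  { apply edist_unique; [assumption | simpl].
    transitivity (x * x * (e1 * e1 + e2 * e2)); [rewrite He |]; ring. }
  split; [| assumption].
  rewrite Hb; apply edist_unique; simpl.
  - pose proof (edist_nonneg a b); lra.
  - transitivity ((edist a b + x) * (edist a b + x) * (e1 * e1 + e2 * e2)); [rewrite He; ring |].
    replace (fst a) with (fst b - edist a b * e1) by lra.
    replace (snd a) with (snd b - edist a b * e2) by lra.
    ring.
Qed.

(** By [edist_between], b' and c' are the images of b and c under a homothety centred at a, and the
    product hypothesis says that both have the same ratio ab' : ab. Hence b' - c' is this multiple
    of b - c, and [edist_scale] compares the lengths. Ratios are kept cross-multiplied, so that a =
    b is covered too. *)
Lemma edist_similarity a b c b' c' :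
  edist a b = edist a b' + edist b' b ->
  edist a c = edist a c' + edist c' c ->
  edist a b' * edist a c = edist a c' * edist a b ->
  edist a b' * edist b c = edist b' c' * edist a b.
Proof.
  intros Hb Hc Hr.
  destruct (edist_between a b b' Hb) as [B1 B2].
  destruct (edist_between a c c' Hc) as [C1 C2].
  pose proof (edist_nonneg a b); pose proof (edist_nonneg a b');
    pose proof (edist_nonneg b' b); pose proof (edist_nonneg a c');
    pose proof (edist_nonneg c' c).
  destruct (Req_dec (edist a c) 0) as [Z | N].
  - assert (Z' : edist a c' = 0) by lra.
    (* Here c and c' both collapse to a. *)
    apply edist_eq_0 in Z; apply edist_eq_0 in Z'; subst c c'.
    rewrite (edist_sym b a), (edist_sym b' a); ring.
  (* This trades the ratio ac' : ac for ab' : ab, by multiplying by ac and cancelling it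
     afterwards. *)
  - assert (D1 : edist a b * (fst c' - fst a) = edist a b' * (fst c - fst a)).
    { apply (Rmult_eq_reg_l (edist a c)); [| assumption].
      transitivity (edist a b * (edist a c * (fst c' - fst a))); [ring |].
      rewrite C1; transitivity ((edist a c' * edist a b) * (fst c - fst a)); [ring |].
      rewrite <- Hr; ring. }
    assert (D2 : edist a b * (snd c' - snd a) = edist a b' * (snd c - snd a)).
    { apply (Rmult_eq_reg_l (edist a c)); [| assumption].
      transitivity (edist a b * (edist a c * (snd c' - snd a))); [ring |].
      rewrite C2; transitivity ((edist a c' * edist a b) * (snd c - snd a)); [ring |].
      rewrite <- Hr; ring. }
    rewrite (Rmult_comm (edist b' c')).
    apply edist_scale; [assumption | assumption | lra | lra].
Qed.

Lemma equilateral_triangle :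
  exists p0 p1 p2, edist p0 p1 <> 0 /\
    edist p0 p1 = edist p0 p2 /\ edist p0 p2 = edist p1 p2.
Proof.
  exists (0, 0), (1, 0), (1 / 2, sqrt 3 / 2).
  assert (S : sqrt 3 * sqrt 3 = 3) by (apply sqrt_sqrt; lra).
  rewrite !(edist_unique _ _ 1); simpl; lra.
Qed.

Lemma no_regular_tetrahedron p0 p1 p2 p3 :
  edist p0 p1 = edist p0 p2 -> edist p0 p2 = edist p0 p3 ->
  edist p0 p3 = edist p1 p2 -> edist p1 p2 = edist p1 p3 ->
  edist p1 p3 = edist p2 p3 -> edist p0 p1 = 0.
Proof.
  intros H1 H2 H3 H4 H5.
  pose proof (edist_sqr p0 p1) as E01; pose proof (edist_sqr p0 p2) as E02;
    pose proof (edist_sqr p0 p3) as E03; pose proof (edist_sqr p1 p2) as E12;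
    pose proof (edist_sqr p1 p3) as E13; pose proof (edist_sqr p2 p3) as E23.
  rewrite <- H5, <- H4, <- H3, <- H2, <- H1 in *.
  clear H1 H2 H3 H4 H5.
  set (d := edist p0 p1) in *; clearbody d.
  destruct p0 as [a1 a2], p1 as [b1 b2], p2 as [c1 c2], p3 as [e1 e2]; simpl in *.
  set (u1 := b1 - a1); set (u2 := b2 - a2); set (v1 := c1 - a1);
    set (v2 := c2 - a2); set (w1 := e1 - a1); set (w2 := e2 - a2).
  assert (UU : u1 * u1 + u2 * u2 = d * d) by (unfold u1, u2; lra).
  assert (VV : v1 * v1 + v2 * v2 = d * d) by (unfold v1, v2; lra).
  assert (WW : w1 * w1 + w2 * w2 = d * d) by (unfold w1, w2; lra).
  (* Polarization: the inner product is half of |u|^2 + |v|^2 - |u - v|^2, and all three terms equal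
     d^2. *)
  assert (UV : u1 * v1 + u2 * v2 = d * d / 2) by (unfold u1, u2, v1, v2; lra).
  assert (UW : u1 * w1 + u2 * w2 = d * d / 2) by (unfold u1, u2, w1, w2; lra).
  assert (VW : v1 * w1 + v2 * w2 = d * d / 2) by (unfold v1, v2, w1, w2; lra).
  (* The Gram determinant of three plane vectors, with names for its entries so that the known
     values can be plugged in. *)
  assert (G : forall uu vv ww uv uw vw : R,
    u1 * u1 + u2 * u2 = uu -> v1 * v1 + v2 * v2 = vv -> w1 * w1 + w2 * w2 = ww ->
    u1 * v1 + u2 * v2 = uv -> u1 * w1 + u2 * w2 = uw -> v1 * w1 + v2 * w2 = vw ->
    uu * vv * ww + 2 * uv * uw * vw - uu * vw * vw - vv * uw * uw - ww * uv * uv = 0)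
    by (intros; subst; ring).
  specialize (G _ _ _ _ _ _ UU VV WW UV UW VW).
  (* With d^2 on the diagonal and d^2 / 2 elsewhere, the determinant is d^6 (1 + 1/4 - 3/4) = d^6 /
     2. *)
  assert (P : d ^ 6 = 0) by lra.
  destruct (Req_dec d 0) as [Z | N]; [assumption |].
  now destruct (pow_nonzero d 6 N).
Qed.

(** The supremum of [A] separates the two sets, each element of [B] being an upper bound of [A]. If
    either set is empty, the conclusion is vacuous and 0 serves as [z]. *)
Lemma real_cut (A B : R -> Prop) :
  (forall x y, A x -> B y -> x < y) ->
  exists z, forall x y, A x -> B y -> x <= z /\ z <= y.
Proof.
  intros H.
  destruct (classic (exists x, A x)) as [HA | HA]; [| exists 0; firstorder].
  destruct (classic (exists y, B y)) as [[y0 HB] | HB]; [| exists 0; firstorder].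
  destruct (completeness A) as [z [Hub Hl]]; [| assumption |].
  - exists y0; intros x Hx; apply Rlt_le; auto.
  - exists z; intros x y Hx Hy; split; [now apply Hub |].
    apply Hl; intros x' Hx'; apply Rlt_le; auto.
Qed.

(** * The axioms hold in the plane *)

Ltac upd_simpl :=
  cbn -[upd]; repeat (rewrite upd_same || (rewrite upd_other by congruence)).

Lemma plane_ordered_field p :
  In p ordered_field_axioms -> forall rho : env plane, sat rho p.
Proof.
  intros H rho; unfold ordered_field_axioms in H.
  repeat destruct H as [<- | H]; try destruct H; upd_simpl;
    set (x := rho (Num 0) : R); set (y := rho (Num 1) : R); set (z := rho (Num 2) : R);
    try (intros; lra).
  - exists (- x); upd_simpl; apply Rplus_opp_r.
  - intros Hx; exists (/ x); upd_simpl; exact (Rinv_r _ Hx).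
  - intros [Hx Hy]; now apply Rmult_lt_0_compat.
Qed.

Lemma sat_upd_agree (M : structure) (rho rho' : env M) v a p :
  rho' v = a -> (forall u, u <> v -> free_in u p -> rho' u = rho u) ->
  (sat rho' p <-> sat (upd rho v a) p).
Proof.
  intros Hv Hu; apply sat_ext; intros u Fu.
  destruct (var_eq_dec v u) as [<- | ne].
  - now rewrite upd_same.
  - rewrite upd_other by assumption; auto.
Qed.

Lemma plane_continuity p :
  continuity_axiom p -> forall rho : env plane, sat rho p.
Proof.
  intros [i j k Phi Psi _ _ Fi Fj Hj Hk Hi Hk'] rho; cbn -[upd].
  apply free_in_appears in Fi; apply free_in_appears in Fj.
  (* Distinctness follows from the side conditions: [Num i] appears in [Phi] whereas [Num j] and
     [Num k] do not, and [Num j] appears in [Psi] whereas [Num k] does not. *)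
  assert (Nij : Num i <> Num j) by congruence.
  assert (Nik : Num k <> Num i) by congruence.
  assert (Njk : Num k <> Num j) by congruence.
  (* The truth of [Phi] varies only with x, and that of [Psi] below only with y. Letting [rho']
     differ from [rho] at [Num k] covers both the premise, evaluated in [rho], and the conclusion,
     where [Num k] has been bound to z. *)
  assert (EPhi : forall (rho' : env plane) (x y : R),
    (forall u, u <> Num k -> rho' u = rho u) ->
    sat (upd (upd rho' (Num i) x) (Num j) y : env plane) Phi <->
    sat (upd rho (Num i) x : env plane) Phi).
  { intros rho' x y E; apply sat_upd_agree.
    - rewrite upd_other by auto; apply upd_same.
    - intros u Hu Fu; apply free_in_appears in Fu.
      rewrite !upd_other by congruence; apply E; congruence. }
  assert (EPsi : forall (rho' : env plane) (x y : R),
    (forall u, u <> Num k -> rho' u = rho u) ->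
    sat (upd (upd rho' (Num i) x) (Num j) y : env plane) Psi <->
    sat (upd rho (Num j) y : env plane) Psi).
  { intros rho' x y E; apply sat_upd_agree.
    - apply upd_same.
    - intros u Hu Fu; apply free_in_appears in Fu.
      rewrite !upd_other by congruence; apply E; congruence. }
  intros H.
  (* The cut consists of the sets that [Phi] and [Psi] define with the parameters given by [rho]. *)
  destruct (real_cut (fun x => sat (upd rho (Num i) x : env plane) Phi)
                     (fun y => sat (upd rho (Num j) y : env plane) Psi)) as [z Hz].
  - intros x y HA HB; specialize (H x y).
    rewrite EPhi, EPsi in H by auto.
    rewrite upd_same, (upd_other _ _ (Num j)), upd_same in H by auto.
    now apply H.
  - exists z; intros x y.
    rewrite EPhi, EPsi by (intros; apply upd_other; auto).
    rewrite !upd_same, !(upd_other _ _ (Num j)), !upd_same by auto.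
    rewrite (upd_other _ _ (Num i)), upd_same by auto.
    intros [HA HB]; exact (Hz x y HA HB).
Qed.

Lemma plane_geometric p :
  In p geometric_axioms -> forall rho : env plane, sat rho p.
Proof.
  intros H rho; unfold geometric_axioms in H.
  repeat destruct H as [<- | H]; try destruct H; upd_simpl.
  - pose proof (edist_nonneg (rho (Pt 0)) (rho (Pt 1))); lra.
  - apply edist_eq_0.
  - apply edist_sym.
  - intros Hx.
    destruct (edist_extend (rho (Pt 0)) (rho (Pt 1)) (rho (Num 0))) as [c Hc];
      [exact Hx |].
    exists c; upd_simpl; exact Hc.
  - intros [Hb [Hc Hr]]; now apply (edist_similarity _ _ _ _ (rho (Pt 4))).
  - destruct equilateral_triangle as [q0 [q1 [q2 Hq]]].
    exists q0, q1, q2; upd_simpl; exact Hq.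
  - intros [H1 [H2 [H3 [H4 H5]]]].
    now apply (no_regular_tetrahedron _ _ (rho (Pt 2)) (rho (Pt 3))).
Qed.

Theorem mainTheorem1 : consistent E_d.
Proof.
  apply (model_consistent plane).
  - constructor; intros [n | n]; [exact (0, 0) | exact 0].
  - intros s [p [Hp ->]]; apply sat_closure.
    destruct Hp as [Hp | [Hp | Hp]];
      [now apply plane_ordered_field | now apply plane_continuity | now apply plane_geometric].
Qed.
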